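(* Let $n\ge 2$ be an integer. If positive real numbers $z_0,\dots,z_n$ satisfy $2z_k<z_0+\cdots+z_n$ for all $0\le k\le n$, then there exist $n+1$ vectors $\boldsymbol{z}_0,\dots,\boldsymbol{z}_n\in\mathbb{R}^n$ which span $\mathbb{R}^n$ and satisfy $$\boldsymbol{z}_0+\cdots+\boldsymbol{z}_n=\boldsymbol{0},\qquad |\boldsymbol{z}_0|=z_0,\ \dots,\ |\boldsymbol{z}_n|=z_n.$$
   Context: $|\cdot|$ denotes the Euclidean norm on $\mathbb{R}^n$. *)

(* Defs.v *)
From mathcomp Require Import all_boot all_order all_algebra.
From mathcomp Require Import reals.

Set Implicit Arguments.
Unset Strict Implicit.
Unset Printing Implicit Defensive.

Import GRing.Theory Num.Theory.
Local Open Scope ring_scope.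

(* The norm `|v| that MathComp-Analysis puts on row vectors is the sup norm,
   so the Euclidean norm is defined here. *)
Definition enorm (R : realType) (n : nat) (v : 'rV[R]_n) : R :=
  Num.sqrt (\sum_(j < n) v ord0 j ^+ 2).

(* Main.v *)
Require Import Defs.
From mathcomp Require Import all_boot all_order all_algebra.
From mathcomp Require Import reals.
From mathcomp Require Import ring lra.
Import Order.TTheory GRing.Theory Num.Theory.
Local Open Scope ring_scope.

(** A closed polygon with [n + 1] sides whose side vectors span an
    [n]-dimensional space is built by adding one side and one dimension at a
    time.  A side [w] of length [b] is replaced by two sides [u], [v] with
    [u + v = w] and prescribed lengths [x], [y], where [u], [v], [w] form a
    nondegenerate triangle in the plane spanned by [w] and a new coordinate
    axis ([realizable_split]).  The triangle is nondegenerate exactly when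
    [u] leaves the old space, so the new sides span one dimension more.

    Read backwards, this merges the first two of the given lengths into a
    diagonal [b].  The diagonal has to satisfy [|x - y| < b < x + y], and the
    shorter list of lengths has to satisfy the strict polygon inequalities
    again.  Every lower bound on [b] is smaller than every upper bound as soon
    as two further sides remain ([exists_diagonal]), so the merging goes on
    until only three sides are left.  Then the diagonal must have the length
    of the third side, and what remains is a segment run through forth and
    back, which spans a line ([realizable_segment]). *)

(** Spanning is expressed dually, as the absence of a nonzero vector orthogonal
    to all sides: this form is the easy one to carry through an added
    coordinate. *)
Definition realizable (R : realType) (n : nat) (a : 'I_n.+1 -> R) : Prop :=
  exists z : 'I_n.+1 -> 'rV[R]_n,
    [/\ forall c : 'cV[R]_n, (forall i, z i *m c = 0) -> c = 0,
        \sum_(i < n.+1) z i = 0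
      & forall i, \sum_(j < n) z i ord0 j ^+ 2 = a i ^+ 2].

Definition merge_first (T : Type) (n : nat) (b : T) (a : 'I_n.+2 -> T) :
    'I_n.+1 -> T :=
  fun i => if unlift ord0 i is Some k then a (lift ord0 (lift ord0 k)) else b.

Lemma merge_first0 (T : Type) (n : nat) (b : T) (a : 'I_n.+2 -> T) :
  merge_first _ _ b a ord0 = b.
Proof. by rewrite /merge_first unlift_none. Qed.

Lemma merge_firstS (T : Type) (n : nat) (b : T) (a : 'I_n.+2 -> T) k :
  merge_first _ _ b a (lift ord0 k) = a (lift ord0 (lift ord0 k)).
Proof. by rewrite /merge_first liftK. Qed.

Lemma forall_ord_recl (n : nat) (P : 'I_n.+1 -> Prop) :
  P ord0 -> (forall k, P (lift ord0 k)) -> forall i, P i.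
Proof. by move=> P0 PS i; case: (unliftP ord0 i) => [k|] ->. Qed.

Lemma span_fullv_orthogonal (R : fieldType) (m n : nat) (z : 'I_m -> 'rV[R]_n) :
  (forall c : 'cV[R]_n, (forall i, z i *m c = 0) -> c = 0) ->
  (<<[seq z i | i : 'I_m]>> = fullv)%VS.
Proof.
move=> z_orth; pose Z := \matrix_i z i.
have Zfull : row_full Z.
  rewrite -cokermx_eq0; apply/eqP/matrixP => j k.
  suff /matrixP/(_ j ord0) : col k (cokermx Z) = 0 by rewrite !mxE.
  apply: z_orth => i.
  by rewrite -[z i](rowK z) -row_mul colE mulmxA -/Z mulmx_coker mul0mx row0.
apply/eqP; rewrite eqEsubv subvf; apply/subvP => v _.
rewrite -[v](mulmxKpV (submx_full v Zfull)) mulmx_sum_row.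
apply: memv_suml => i _; apply/memvZ/memv_span.
by rewrite rowK; apply/imageP; exists i.
Qed.

(** The apex of a triangle with base [b] and sides [x], [y] has its foot at the
    fraction [s] of the base and its height [h] given by the law of cosines;
    [h] is nonzero by Heron's formula. *)
Lemma triangle_foot_height (R : rcfType) (x y b : R) :
  0 < b -> `|x - y| < b -> b < x + y ->
  exists s h : R, [/\ h != 0, h ^+ 2 + s ^+ 2 * b ^+ 2 = x ^+ 2
                    & h ^+ 2 + (1 - s) ^+ 2 * b ^+ 2 = y ^+ 2].
Proof.
move=> b_gt0; rewrite ltr_norml => /andP[ltyx ltxy] ltb.
have b_neq0 : b != 0 by rewrite gt_eqF.
pose s := (x ^+ 2 - y ^+ 2 + b ^+ 2) / (2 * b ^+ 2).
pose q := (x + y + b) * (x + y - b) * ((b - (x - y)) * (b + (x - y))) /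
          (4 * b ^+ 2).
have q_gt0 : 0 < q.
  rewrite divr_gt0 ?mulr_gt0 ?exprn_gt0 //; lra.
exists s, (Num.sqrt q); split.
- by rewrite gt_eqF // sqrtr_gt0.
- by rewrite sqr_sqrtr ?ltW // /q /s; field.
- by rewrite sqr_sqrtr ?ltW // /q /s; field.
Qed.

Lemma realizable_split (R : realType) (n : nat) (a : 'I_n.+2 -> R) (b : R) :
  0 < b -> `|a ord0 - a (lift ord0 ord0)| < b ->
  b < a ord0 + a (lift ord0 ord0) ->
  realizable _ _ (merge_first _ _ b a) -> realizable _ _ a.
Proof.
move=> b_gt0 lb ub [z [z_orth z_sum z_norm]].
have [s [h [h_neq0 xE yE]]] := triangle_foot_height _ _ _ _ b_gt0 lb ub.
(* The first coordinate is the new one. *)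
pose side (t : R) (v : 'rV[R]_n) : 'rV[R]_(1 + n) := row_mx t%:M v.
have side_norm t v : \sum_j side t v ord0 j ^+ 2 =
                     t ^+ 2 + \sum_j v ord0 j ^+ 2.
  rewrite big_split_ord big_ord1 /= row_mxEl mxE mulr1n; congr (_ + _).
  by apply: eq_bigr => j _; rewrite row_mxEr.
pose z' (i : 'I_n.+2) : 'rV[R]_(1 + n) :=
  if unlift ord0 i is Some j then
    if unlift ord0 j is Some k then side 0 (z (lift ord0 k))
    else side (- h) ((1 - s) *: z ord0)
  else side h (s *: z ord0).
have z'0 : z' ord0 = side h (s *: z ord0) by rewrite /z' unlift_none.
have z'1 : z' (lift ord0 ord0) = side (- h) ((1 - s) *: z ord0).
  by rewrite /z' liftK unlift_none.
have z'SS k : z' (lift ord0 (lift ord0 k)) = side 0 (z (lift ord0 k)).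
  by rewrite /z' !liftK.
have z0_norm : \sum_j z ord0 ord0 j ^+ 2 = b ^+ 2.
  by rewrite z_norm merge_first0.
have scaled_norm t : \sum_j (t *: z ord0) ord0 j ^+ 2 = t ^+ 2 * b ^+ 2.
  by rewrite -z0_norm mulr_sumr; apply: eq_bigr => j _; rewrite mxE exprMn.
exists z'; split.
- move=> c; rewrite -[c](@vsubmxK _ 1 n 1).
  set c0 := usubmx _; set c1 := dsubmx _ => c_orth.
  have side_orth t v : side t v *m col_mx c0 c1 = t *: c0 + v *m c1.
    by rewrite mul_row_col mul_scalar_mx.
  have e0 := c_orth ord0; rewrite z'0 side_orth -scalemxAl in e0.
  have e1 := c_orth (lift ord0 ord0).
  rewrite z'1 side_orth -scalemxAl in e1.
  (* The new coordinate cancels in the sum of the first two sides, which is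
     the diagonal. *)
  have zc0 : z ord0 *m c1 = 0.
    rewrite -[RHS]addr0 -{1}e0 -e1 addrACA -!scalerDl subrr scale0r add0r.
    by rewrite [s + _]addrC subrK scale1r.
  have c1_eq0 : c1 = 0.
    apply: z_orth; apply: forall_ord_recl => // k.
    by have := c_orth (lift ord0 (lift ord0 k));
       rewrite z'SS side_orth scale0r add0r.
  move/eqP: e0; rewrite zc0 scaler0 addr0 scaler_eq0 (negPf h_neq0) /=.
  by move/eqP=> c0_eq0; rewrite c0_eq0 c1_eq0 col_mx0.
- have sideD t t' v v' : side t v + side t' v' = side (t + t') (v + v').
    by rewrite /side add_row_mx raddfD.
  have side0_sum (w : 'I_n -> 'rV[R]_n) : \sum_k side 0 (w k) = side 0 (\sum_k w k).
    elim/big_rec2: _ => [|k u v _ ->]; first by rewrite /side raddf0 row_mx0.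
    by rewrite sideD addr0.
  rewrite 2!big_ord_recl z'0 z'1 (eq_bigr _ (fun k _ => z'SS k)) side0_sum.
  rewrite !sideD addr0 subrr addrA -scalerDl addrC [s + _]addrC subrK scale1r.
  by rewrite addrC -big_ord_recl z_sum /side raddf0 row_mx0.
- apply: forall_ord_recl; first by rewrite z'0 side_norm scaled_norm.
  apply: forall_ord_recl => [|k]; first by rewrite z'1 side_norm scaled_norm sqrrN.
  by rewrite z'SS side_norm expr0n add0r z_norm merge_firstS.
Qed.

Lemma realizable_segment (R : realType) (a : 'I_2 -> R) :
  a ord0 != 0 -> a (lift ord0 ord0) = a ord0 -> realizable _ _ a.
Proof.
move=> a_neq0 a_eq.
exists (fun i => if i == ord0 then (a ord0)%:M else - (a ord0)%:M); split.
- move=> c /(_ ord0); rewrite eqxx mul_scalar_mx => /eqP.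
  by rewrite scaler_eq0 (negPf a_neq0) => /eqP.
- by rewrite big_ord_recl big_ord1 /= subrr.
- apply: forall_ord_recl => [|k]; rewrite big_ord1 /= !mxE ?mulr1n //.
  by rewrite ord1 a_eq sqrrN.
Qed.

(** The bounds on [b] are: the triangle inequalities with [x] and [y], and the
    polygon inequalities with the remaining sides [a k], of sum [S].  The
    hypotheses put each of the lower bounds [|x - y|], [2 a_k - S] below each
    of the upper bounds [x + y], [S]; that [2 a_k - S < S], i.e. [a_k < S],
    comes from the presence of another positive term in [S]. *)
Lemma exists_diagonal (R : realFieldType) (n : nat) (x y : R)
    (a : 'I_n.+2 -> R) (S := \sum_(i < n.+2) a i) :
  0 < x -> 0 < y -> (forall k, 0 < a k) ->
  x < y + S -> y < x + S -> (forall k, 2 * a k < x + y + S) ->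
  exists b, [/\ `|x - y| < b, b < x + y, b < S & forall k, 2 * a k < b + S].
Proof.
move=> x_gt0 y_gt0 a_gt0 ltx lty lta.
have ltaS k : a k < S.
  rewrite /S (bigD1 k) //= ltrDl lt_neqAle eq_sym; apply/andP; split; last first.
    by apply: sumr_ge0 => i _; apply: ltW.
  rewrite psumr_neq0 => [|i _]; last exact: ltW.
  by apply/hasP; exists (lift k ord0);
    rewrite ?mem_index_enum // a_gt0 eq_sym neq_lift.
pose L := \big[Order.max/`|x - y|]_k (2 * a k - S).
pose U := Num.min (x + y) S.
have ltLU : L < U.
  apply: bigmax_lt => [|k _]; rewrite /U lt_min ?ltr_norml.
    by apply/andP; split; [apply/andP; split|apply/andP; split]; lra.
  by have := lta k; have := ltaS k => h1 h2; apply/andP; split; lra.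
have [Uxy US] : U <= x + y /\ U <= S by rewrite /U !ge_min !lexx orbT.
have leL : `|x - y| <= L by apply: bigmax_ge_id.
have lekL k : 2 * a k - S <= L by apply: le_bigmax.
exists ((L + U) / 2); split; try lra.
by move=> k; have := lekL k => h; lra.
Qed.

Lemma polygon_realizable (R : realType) (n : nat) (a : 'I_n.+3 -> R) :
  (forall k, 0 < a k) -> (forall k, 2 * a k < \sum_(i < n.+3) a i) ->
  realizable _ _ a.
Proof.
elim: n a => [|n IHn] a a_gt0 ha.
  have x_gt0 := a_gt0 ord0; have y_gt0 := a_gt0 (lift ord0 ord0).
  have := ha ord0; have := ha (lift ord0 ord0).
  have := ha (lift ord0 (lift ord0 ord0)); rewrite !big_ord_recl big_ord0 addr0.
  have b_gt0 := a_gt0 (lift ord0 (lift ord0 ord0)).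
  move=> hb hy hx.
  apply: (realizable_split _ _ _ (a (lift ord0 (lift ord0 ord0)))) => //.
  - by rewrite ltr_norml; apply/andP; split; lra.
  - by lra.
  by apply: realizable_segment; rewrite ?merge_firstS merge_first0 ?gt_eqF.
pose t (k : 'I_n.+2) := a (lift ord0 (lift ord0 k)).
have sumE : \sum_i a i = a ord0 + a (lift ord0 ord0) + \sum_i t i.
  by rewrite 2!big_ord_recl addrA.
have [|||||k|b [lb ub bS tb]] :=
  exists_diagonal _ _ (a ord0) (a (lift ord0 ord0)) t _ _ _ _ _ _ => //.
- by move=> k; apply: a_gt0.
- by have := ha ord0; rewrite sumE => h; lra.
- by have := ha (lift ord0 ord0); rewrite sumE => h; lra.
- by have := ha (lift ord0 (lift ord0 k)); rewrite sumE.
have b_gt0 : 0 < b by apply: le_lt_trans lb.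
apply: (realizable_split _ _ _ b) => //.
have sum_merge : \sum_i merge_first _ _ b a i = b + \sum_i t i.
  rewrite big_ord_recl merge_first0; congr (_ + _).
  by apply: eq_bigr => k _; rewrite merge_firstS.
apply: IHn; apply: forall_ord_recl => [|k].
- by rewrite merge_first0.
- by rewrite merge_firstS.
- by rewrite sum_merge merge_first0; lra.
- by rewrite sum_merge merge_firstS; apply: tb.
Qed.

Theorem mainTheorem2 (R : realType) (n : nat) (hn : (2 <= n)%N)
    (a : 'I_n.+1 -> R) (a_gt0 : forall k, 0 < a k)
    (ha : forall k, 2 * a k < \sum_(i < n.+1) a i) :
  exists z : 'I_n.+1 -> 'rV[R]_n,
    [/\ (<<[seq z i | i : 'I_n.+1]>> = fullv)%VS,
        \sum_(i < n.+1) z i = 0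
      & forall i, enorm (z i) = a i].
Proof.
case: n hn a a_gt0 ha => [|[|n]] // _ a a_gt0 ha.
have [z [z_orth z_sum z_norm]] := polygon_realizable _ _ a a_gt0 ha.
exists z; split=> [|//|i]; first exact: span_fullv_orthogonal.
by rewrite /enorm z_norm sqrtr_sqr gtr0_norm.
Qed.
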